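(* Let $\Gamma^0=\mathbf{X}^0=(x^0,y^0)^T\in\mathbb{X}^h$ be given with $x_l^0=x^0(0)<x_r^0=x^0(1)$, and for $m\ge0$ let $(\mathbf{X}^{m+1},\kappa^{m+1})\in\mathbb{X}^h\times\mathbb{K}^h$ be the solution of $$\Bigl(\frac{\mathbf{X}^{m+1}-\mathbf{X}^m}{\tau}\cdot\mathbf{n}^m,\psi^h\Bigr)^h_{\Gamma^m}+\bigl(\partial_s\kappa^{m+1},\partial_s\psi^h\bigr)_{\Gamma^m}=0,\qquad\forall\,\psi^h\in\mathbb{K}^h,$$ $$\bigl(\kappa^{m+1},\mathbf{n}^m\cdot\boldsymbol{\omega}^h\bigr)^h_{\Gamma^m}-\bigl(\partial_s\mathbf{X}^{m+1},\partial_s\boldsymbol{\omega}^h\bigr)_{\Gamma^m}+\sigma\bigl[\omega^h_1(1)-\omega^h_1(0)\bigr]-\frac{1}{\eta\tau}\bigl[\omega^h_1(0)(x_l^{m+1}-x_l^m)+\omega^h_1(1)(x_r^{m+1}-x_r^m)\bigr]=0,\qquad\forall\,\boldsymbol{\omega}^h=(\omega^h_1,\omega^h_2)^T\in\mathbb{X}^h,$$ where $\Gamma^m=\mathbf{X}^m=(x^m,y^m)^T$, and $x_l^m=x^m(0)$ and $x_r^m=x^m(1)$ are assumed to satisfy $x_l^m\le x_r^m$. Then the energy is decreasing, $$W^{m+1}\le W^m\le W^0=|\Gamma^0|-\sigma(x_r^0-x_l^0),\qquad m\ge0.$$ Moreover, $$\sum_{k=1}^{m+1}\left[\bigl(\partial_s\kappa^k,\partial_s\kappa^k\bigr)_{\Gamma^{k-1}}+\frac1\eta\Bigl(\frac{x_l^k-x_l^{k-1}}{\tau}\Bigr)^2+\frac1\eta\Bigl(\frac{x_r^k-x_r^{k-1}}{\tau}\Bigr)^2\right]\le\frac{W^0-W^{m+1}}{\tau},\qquad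 m\ge0.$$
   Context: $\mathbf{I}=[0,1]$; $\sigma\in(-1,1)$ and $\eta>0$ are constants; $\tau>0$ is the time step; $N\ge1$ is an integer, $h=1/N$, $\rho_j=jh$ and $I_j=[\rho_{j-1},\rho_j]$. $\mathbb{K}^h$ is the space of continuous functions on $\mathbf{I}$ that are affine on each $I_j$; $\mathbb{K}^h_0=\{u\in\mathbb{K}^h:u(0)=u(1)=0\}$; $\mathbb{X}^h=\mathbb{K}^h\times\mathbb{K}^h_0$. Write $\mathbf{h}^m_j=\mathbf{X}^m(\rho_j)-\mathbf{X}^m(\rho_{j-1})$; it is assumed that $|\mathbf{h}^m_j|>0$ for all $j$ and $m$, so that the scheme is meaningful. On $I_j$ the unit tangent of $\Gamma^m$ is $\boldsymbol{\tau}^m_j=\mathbf{h}^m_j/|\mathbf{h}^m_j|$ and the unit normal is $\mathbf{n}^m_j=-(\boldsymbol{\tau}^m_j)^\perp$, where $(\cdot)^\perp$ is clockwise rotation by $90$ degrees (so $(a,b)^T\mapsto(b,-a)^T$); $\mathbf{n}^m$ is the piecewise constant function with value $\mathbf{n}^m_j$ on $I_j$. Inside $(\cdot,\cdot)_{\Gamma^m}$, on $I_j$, $\partial_s=\frac{h}{|\mathbf{h}^m_j|}\partial_\rho$ (derivative with respect to arc length of $\Gamma^m$). $(u,v)_{\Gamma^m}$ is the $L^2$ inner product along $\Gamma^m$ with respect to arc length, and the mass-lumped inner product is $$(u,v)^h_{\Gamma^m}=\frac12\sum_{j=1}^N|\mathbf{h}^m_j|\bigl[(u\cdot v)(\rho_j^-)+(u\cdot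 v)(\rho_{j-1}^+)\bigr],$$ with one-sided limits at the nodes. The energy is $W^m=|\Gamma^m|-\sigma(x_r^m-x_l^m)$, where $|\Gamma^m|=\sum_{j=1}^N|\mathbf{h}^m_j|$ is the length of $\Gamma^m$. *)

(* Defs.v *)
From HB Require Import structures.
From mathcomp Require Import all_boot all_order all_algebra.
From mathcomp Require Import all_classical all_reals all_analysis.
Set Implicit Arguments.
Unset Strict Implicit.
Unset Printing Implicit Defensive.
Import Order.TTheory GRing.Theory Num.Theory.
Import numFieldNormedType.Exports.
Local Open Scope classical_set_scope.
Local Open Scope ring_scope.

(* Vectors of the plane are pairs.  The library norm on R * R is the max norm,
   so the Euclidean structure is defined here. *)
Definition dot2 (R : realType) (u v : R * R) : R := u.1 * v.1 + u.2 * v.2.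

Definition norm2 (R : realType) (u : R * R) : R := Num.sqrt (dot2 u u).

Definition scale2 (R : realType) (c : R) (u : R * R) : R * R :=
  (c * u.1, c * u.2).

(* clockwise rotation by 90 degrees *)
Definition perp2 (R : realType) (u : R * R) : R * R := (u.2, - u.1).

Definition mesh_size (R : realType) (N : nat) : R := N%:R^-1.

Definition node (R : realType) (N j : nat) : R := j%:R * mesh_size R N.

(* The elements are I_j = [node j.-1, node j] for 1 <= j <= N.  Functions on
   [0, 1] are total functions on R; nothing below depends on their values
   outside [0, 1]. *)
Definition in_Kh (R : realType) (N : nat) (u : R -> R) : Prop :=
  {within `[0, 1], continuous u} /\
  forall j : nat, (1 <= j <= N)%N ->
    exists a b : R, forall r : R,
      node R N j.-1 <= r <= node R N j -> u r = a * r + b.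

Definition in_Kh0 (R : realType) (N : nat) (u : R -> R) : Prop :=
  [/\ in_Kh N u, u 0 = 0 & u 1 = 0].

Definition in_Xh (R : realType) (N : nat) (X : R -> R * R) : Prop :=
  in_Kh N (fun r => (X r).1) /\ in_Kh0 N (fun r => (X r).2).

Definition edge (R : realType) (N : nat) (X : R -> R * R) (j : nat) : R * R :=
  X (node R N j) - X (node R N j.-1).

Definition curve_length (R : realType) (N : nat) (X : R -> R * R) : R :=
  \sum_(1 <= j < N.+1) norm2 (edge N X j).

Definition energy (R : realType) (N : nat) (sigma : R) (X : R -> R * R) : R :=
  curve_length N X - sigma * ((X 1).1 - (X 0).1).

(* The piecewise constant function with value c j on I_j.  An interior node is
   attached to the element on its right, and the value at 1 is 0; these values
   at the nodes enter neither the integrals nor the one-sided limits below. *)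
Definition pw_const (R : realType) (N : nat) (c : nat -> R) (r : R) : R :=
  \sum_(1 <= j < N.+1 | node R N j.-1 <= r < node R N j) c j.

Definition tangent_on (R : realType) (N : nat) (X : R -> R * R) (j : nat)
    : R * R :=
  scale2 (norm2 (edge N X j))^-1 (edge N X j).

Definition normal_on (R : realType) (N : nat) (X : R -> R * R) (j : nat)
    : R * R :=
  - perp2 (tangent_on N X j).

Definition normal (R : realType) (N : nat) (X : R -> R * R) (r : R) : R * R :=
  (pw_const N (fun j => (normal_on N X j).1) r,
   pw_const N (fun j => (normal_on N X j).2) r).

(* Derivative with respect to the arc length of the polygonal curve X. *)
Definition arc_deriv (R : realType) (N : nat) (X : R -> R * R) (u : R -> R)
    (r : R) : R :=
  pw_const N (fun j => mesh_size R N / norm2 (edge N X j)) r * derive1 u r.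

Definition arc_deriv2 (R : realType) (N : nat) (X U : R -> R * R) (r : R)
    : R * R :=
  (arc_deriv N X (fun t => (U t).1) r, arc_deriv N X (fun t => (U t).2) r).

(* Integral along the curve: on I_j the arc length element is
   (|edge j| / mesh_size) dr. *)
Definition arc_integral (R : realType) (N : nat) (X : R -> R * R) (w : R -> R)
    : R :=
  \sum_(1 <= j < N.+1)
    \int[lebesgue_measure]_(r in `[node R N j.-1, node R N j])
      (w r * (norm2 (edge N X j) / mesh_size R N)).

Definition arc_inner (R : realType) (N : nat) (X : R -> R * R) (u v : R -> R)
    : R :=
  arc_integral N X (fun r => u r * v r).

Definition arc_inner2 (R : realType) (N : nat) (X U V : R -> R * R) : R :=
  arc_integral N X (fun r => dot2 (U r) (V r)).

Definition lumped_inner (R : realType) (N : nat) (X : R -> R * R)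
    (u v : R -> R) : R :=
  2^-1 * (\sum_(1 <= j < N.+1) norm2 (edge N X j) *
    (lim (u r * v r @[r --> (node R N j)^'-]) +
     lim (u r * v r @[r --> (node R N j.-1)^'+]))).

(* Main.v *)
Require Import Defs.
From HB Require Import structures.
From mathcomp Require Import all_boot all_order all_algebra.
From mathcomp Require Import all_classical all_reals all_analysis.
From mathcomp Require Import measurable_realfun ring lra.
Set Implicit Arguments.
Unset Strict Implicit.
Unset Printing Implicit Defensive.
Import Order.TTheory GRing.Theory Num.Theory.
Import numFieldNormedType.Exports.
Local Open Scope classical_set_scope.
Local Open Scope ring_scope.

(** Testing the discrete equation of motion with the new curvature [kappa']
    and the curvature equation with the discrete velocity [(X' - X) / tau]
    makes the mass-lumped terms of both equations equal, so that they cancel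
    on subtraction.  What remains is the balance
    [tau * dissipation = - (d_s X', d_s (X' - X)) + sigma * (change of width)].
    The only inequality in the proof is then a discrete form of the fact that
    the Dirichlet energy controls the length: on an element with old edge [b]
    and new edge [a] the inner product equals [a . (a - b) / |b|], and
    [|a|^2 / |b| - a . b / |b| >= |a|^2 / |b| - |a| >= |a| - |b|]
    by Cauchy-Schwarz and [(|a| - |b|)^2 >= 0] ([length_increment_le]).
    Summing over the elements bounds the inner product below by the increment
    of length, which gives [tau * dissipation <= W - W'] for one step
    ([energy_step]); the dissipation is nonnegative, and telescoping gives
    both claims.

    The remaining work is to evaluate the inner products along the curve, whose
    integrands are constant on each open element ([arc_integral_pw],
    [arc_derivE]). *)

(** * Euclidean geometry of the plane *)

Lemma norm2_ge0 (R : realType) (u : R * R) : 0 <= norm2 u.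
Proof. exact: sqrtr_ge0. Qed.

Lemma sqr_norm2 (R : realType) (u : R * R) : norm2 u ^+ 2 = dot2 u u.
Proof. by rewrite sqr_sqrtr// addr_ge0// -expr2 sqr_ge0. Qed.

(** Lagrange's identity: the defect in the square is the square of the
    determinant of the two vectors. *)
Lemma dot2_le_norm2 (R : realType) (u v : R * R) :
  dot2 u v <= norm2 u * norm2 v.
Proof.
apply: le_trans (ler_norm _) _.
rewrite -(ler_pXn2r (n := 2)) ?nnegrE ?mulr_ge0 ?norm2_ge0//.
rewrite real_normK ?num_real// exprMn !sqr_norm2 -subr_ge0.
rewrite (_ : _ - _ = (u.1 * v.2 - u.2 * v.1) ^+ 2) ?sqr_ge0//.
by rewrite /dot2; ring.
Qed.

(** After Cauchy-Schwarz the difference of the two sides, times [|b|], is at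
    least [(|a| - |b|)^2]; this is the estimate behind the decay of energy. *)
Lemma length_increment_le (R : realType) (a b : R * R) :
  0 < norm2 b -> norm2 a - norm2 b <= dot2 a (a - b) / norm2 b.
Proof.
move=> b0; rewrite ler_pdivlMr//.
have -> : dot2 a (a - b) = norm2 a ^+ 2 - dot2 a b.
  by rewrite sqr_norm2 /dot2/=; ring.
have ab := dot2_le_norm2 a b.
have sq : 0 <= (norm2 a - norm2 b) ^+ 2 by exact: sqr_ge0.
nra.
Qed.

(** * Piecewise constant and piecewise affine functions on the mesh *)

Lemma mesh_size_gt0 (R : realType) (N : nat) : (1 <= N)%N -> 0 < mesh_size R N.
Proof. by move=> N1; rewrite invr_gt0 ltr0n. Qed.

Lemma node_le (R : realType) (N i j : nat) :
  (i <= j)%N -> node R N i <= node R N j.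
Proof. by move=> ij; rewrite ler_wpM2r ?invr_ge0 ?ler0n// ler_nat. Qed.

Lemma node_sub (R : realType) (N j : nat) :
  (1 <= j)%N -> node R N j - node R N j.-1 = mesh_size R N.
Proof.
by case: j => // j _; rewrite /node -mulrBl -natrB// subSnn mul1r.
Qed.

Lemma node_pred_lt (R : realType) (N j : nat) : (1 <= N)%N -> (1 <= j)%N ->
  node R N j.-1 < node R N j.
Proof. by move=> N1 j1; rewrite -subr_gt0 node_sub// mesh_size_gt0. Qed.

Lemma pw_constE (R : realType) (N j : nat) (c : nat -> R) (r : R) :
  (1 <= j <= N)%N -> node R N j.-1 < r < node R N j -> pw_const N c r = c j.
Proof.
move=> /andP[j1 jN] /andP[jr rj].
rewrite /pw_const big_mkcond/=.
rewrite (eq_bigr (fun k => if k == j then c k else 0)); last first.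
  move=> k _; congr (if _ then _ else _).
  have [->|kj] := eqVneq k j; first by rewrite (ltW jr) rj.
  apply/negbTE/negP => /andP[kr rk].
  have [ltkj|lejk] := ltnP k j.
    have : node R N k <= node R N j.-1 by apply: node_le; rewrite -ltnS prednK.
    lra.
  have : node R N j <= node R N k.-1.
    have ltjk : (j < k)%N by rewrite ltn_neqAle eq_sym kj.
    by apply: node_le; rewrite -ltnS prednK// (leq_trans _ ltjk).
  lra.
by rewrite -big_mkcond big_nat1_eq j1 ltnS jN.
Qed.

Lemma in_KhZB (R : realType) (N : nat) (c : R) (u v : R -> R) :
  in_Kh N u -> in_Kh N v -> in_Kh N (fun r => c * (u r - v r)).
Proof.
move=> [cu au] [cv av]; split.
  by move=> x; apply: cvgM; [exact: cvg_cst|apply: cvgB; [exact: cu|exact: cv]].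
move=> j jN; have [a [b ub]] := au j jN; have [a' [b' vb]] := av j jN.
exists (c * (a - a')), (c * (b - b')) => r rj.
by rewrite ub// vb//; ring.
Qed.

Lemma in_XhZB (R : realType) (N : nat) (c : R) (U V : R -> R * R) :
  in_Xh N U -> in_Xh N V -> in_Xh N (fun r => scale2 c (U r - V r)).
Proof.
move=> [U1 [U2 U20 U21]] [V1 [V2 V20 V21]]; split; first exact: in_KhZB.
split; first exact: (in_KhZB c U2 V2).
- by rewrite /= U20 V20 subrr mulr0.
- by rewrite /= U21 V21 subrr mulr0.
Qed.

Lemma edge_scaleB (R : realType) (N j : nat) (c : R) (U V : R -> R * R) :
  edge N (fun r => scale2 c (U r - V r)) j = scale2 c (edge N U j - edge N V j).
Proof. by rewrite /edge /scale2 /=; congr pair; rewrite /=; ring. Qed.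

Lemma in_Kh_derive1 (R : realType) (N j : nat) (u : R -> R) (r : R) :
  (1 <= N)%N -> in_Kh N u -> (1 <= j <= N)%N ->
  node R N j.-1 < r < node R N j ->
  derive1 u r = (u (node R N j) - u (node R N j.-1)) / mesh_size R N.
Proof.
move=> N1 [_ au] jN jr; have [a [b ab]] := au j jN.
have j1 : (1 <= j)%N by case/andP: jN.
have h0 := mesh_size_gt0 R N1.
have jj := ltW (node_pred_lt R N1 j1).
have -> : derive1 u r = a.
  rewrite derive1E (near_eq_derive (g := fun x => a * x + b)).
    rewrite deriveD//.
    by rewrite derive_cst addr0 deriveZ//= derive_id /GRing.scale/= mulr1.
  have rj : r \in `]node R N j.-1, node R N j[ by rewrite in_itv.
  near=> x; apply: ab.
  have : x \in `]node R N j.-1, node R N j[ by near: x; exact: near_in_itvoo rj.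
  by rewrite in_itv/= => /andP[/ltW-> /ltW->].
rewrite !ab ?lexx ?jj// (_ : _ - _ = a * (node R N j - node R N j.-1)).
  by rewrite node_sub// mulfK// gt_eqF.
by ring.
Unshelve. all: by end_near. Qed.

(** * Inner products along the polygonal curve *)

Lemma arc_derivE (R : realType) (N j : nat) (X : R -> R * R) (u : R -> R)
    (r : R) :
  (1 <= N)%N -> in_Kh N u -> (1 <= j <= N)%N ->
  node R N j.-1 < r < node R N j ->
  arc_deriv N X u r =
    (u (node R N j) - u (node R N j.-1)) / norm2 (edge N X j).
Proof.
move=> N1 uK jN jr; have h0 := mesh_size_gt0 R N1.
rewrite /arc_deriv (pw_constE _ jN jr) (in_Kh_derive1 N1 uK jN jr).
by set ni := (norm2 _)^-1; field; rewrite gt_eqF.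
Qed.

(** The endpoints of an element form a null set, so the integrand matters only
    where [pw_const] and the derivative have their expected values. *)
Lemma arc_integral_pw (R : realType) (N : nat) (X : R -> R * R) (w : R -> R)
    (c : nat -> R) :
  (1 <= N)%N ->
  (forall j r, (1 <= j <= N)%N -> node R N j.-1 < r < node R N j ->
     w r = c j) ->
  arc_integral N X w = \sum_(1 <= j < N.+1) c j * norm2 (edge N X j).
Proof.
move=> N1 wc; apply: eq_big_nat => j; rewrite ltnS => jN.
have h0 := mesh_size_gt0 R N1.
have j1 : (1 <= j)%N by case/andP: jN.
set k := c j * (norm2 (edge N X j) / mesh_size R N).
have wk : {in `]node R N j.-1, node R N j[%classic,
    (fun=> k) =1 (fun r => w r * (norm2 (edge N X j) / mesh_size R N))}.
  by move=> r; rewrite inE/= in_itv/= => jr; rewrite (wc j).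
transitivity (\int[lebesgue_measure]_(r in `]node R N j.-1, node R N j[) k).
  rewrite [LHS]/Rintegral integral_itv_bndoo; last first.
    apply/measurable_EFinP.
    exact: (eq_measurable_fun _ wk (measurable_cst _)).
  by congr fine; apply: eq_integral => r /wk <-.
rewrite Rintegral_cst//=.
rewrite lebesgue_measure_itv/= lte_fin node_pred_lt//= node_sub// /k.
by field; rewrite gt_eqF.
Qed.

(** Each arc length derivative contributes a factor [1 / |edge|], and the
    length of the element cancels one of them. *)
Lemma arc_inner2_deriv (R : realType) (N : nat) (X U V : R -> R * R) :
  (1 <= N)%N ->
  (forall j, (1 <= j <= N)%N -> 0 < norm2 (edge N X j)) ->
  in_Xh N U -> in_Xh N V ->
  arc_inner2 N X (arc_deriv2 N X U) (arc_deriv2 N X V) =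
  \sum_(1 <= j < N.+1) dot2 (edge N U j) (edge N V j) / norm2 (edge N X j).
Proof.
move=> N1 X0 [U1 [U2 _ _]] [V1 [V2 _ _]].
rewrite /arc_inner2 (arc_integral_pw (c := fun j =>
  dot2 (edge N U j) (edge N V j) / norm2 (edge N X j) ^+ 2) _ N1).
  apply: eq_big_nat => j; rewrite ltnS => jN.
  by field; rewrite gt_eqF ?X0.
move=> j r jN jr; rewrite /arc_deriv2 /dot2/= !(arc_derivE (j := j))//.
by rewrite /edge/=; field; rewrite gt_eqF ?X0.
Qed.

Lemma arc_inner_ge0 (R : realType) (N : nat) (X : R -> R * R) (u : R -> R) :
  0 <= arc_inner N X u u.
Proof.
apply: sumr_ge0 => j _; apply: Rintegral_ge0 => r _.
by rewrite mulr_ge0 -?expr2 ?sqr_ge0// divr_ge0 ?norm2_ge0// invr_ge0 ler0n.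
Qed.

Lemma eq_lumped_inner (R : realType) (N : nat) (X : R -> R * R)
    (u v u' v' : R -> R) :
  (forall r, u r * v r = u' r * v' r) ->
  lumped_inner N X u v = lumped_inner N X u' v'.
Proof. by move=> /funext uv; rewrite /lumped_inner uv. Qed.

(** * Energy balance over one time step *)

(** The three terms are the rates of energy loss by surface diffusion and by
    the friction of the left and of the right contact point. *)
Definition dissipation (R : realType) (eta tau : R) (N : nat)
    (X X' : R -> R * R) (kappa' : R -> R) : R :=
  arc_inner N X (arc_deriv N X kappa') (arc_deriv N X kappa')
  + eta^-1 * (((X' 0).1 - (X 0).1) / tau) ^+ 2
  + eta^-1 * (((X' 1).1 - (X 1).1) / tau) ^+ 2.

Lemma dissipation_ge0 (R : realType) (eta tau : R) (N : nat)
    (X X' : R -> R * R) (kappa' : R -> R) :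
  0 < eta -> 0 <= dissipation eta tau N X X' kappa'.
Proof.
move=> eta0; have e0 : 0 <= eta^-1 by rewrite invr_ge0 ltW.
by rewrite !addr_ge0 ?arc_inner_ge0// mulr_ge0// sqr_ge0.
Qed.

Lemma curve_length_increment_le (R : realType) (N : nat) (tau : R)
    (X X' : R -> R * R) :
  (1 <= N)%N -> 0 < tau ->
  (forall j, (1 <= j <= N)%N -> 0 < norm2 (edge N X j)) ->
  in_Xh N X -> in_Xh N X' ->
  curve_length N X' - curve_length N X <=
  tau * arc_inner2 N X (arc_deriv2 N X X')
          (arc_deriv2 N X (fun r => scale2 tau^-1 (X' r - X r))).
Proof.
move=> N1 tau0 X0 XX XX'; rewrite arc_inner2_deriv//; last exact: in_XhZB.
rewrite mulr_sumr /curve_length -sumrB; apply: ler_sum_nat => j jN.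
rewrite edge_scaleB.
apply: le_trans (length_increment_le _ (X0 j jN)) _.
rewrite mulrA ler_pM2r ?invr_gt0 ?X0// /dot2 /=.
rewrite le_eqVlt; apply/orP; left; apply/eqP.
by field; rewrite gt_eqF.
Qed.

(** The velocity, rather than the displacement [X' - X], is the test function in
    the curvature equation: the two lumped products then agree pointwise, and
    no one-sided limit has to be computed. *)
Lemma energy_step (R : realType) (sigma eta tau : R) (N : nat)
    (X X' : R -> R * R) (kappa' : R -> R) :
  0 < eta -> 0 < tau -> (1 <= N)%N ->
  in_Xh N X -> in_Xh N X' -> in_Kh N kappa' ->
  (forall j, (1 <= j <= N)%N -> 0 < norm2 (edge N X j)) ->
  (forall psi, in_Kh N psi ->
     lumped_inner N X
       (fun r => dot2 (scale2 tau^-1 (X' r - X r)) (normal N X r)) psi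
     + arc_inner N X (arc_deriv N X kappa') (arc_deriv N X psi) = 0) ->
  (forall omega, in_Xh N omega ->
     lumped_inner N X kappa' (fun r => dot2 (normal N X r) (omega r))
     - arc_inner2 N X (arc_deriv2 N X X') (arc_deriv2 N X omega)
     + sigma * ((omega 1).1 - (omega 0).1)
     - (eta * tau)^-1 * ((omega 0).1 * ((X' 0).1 - (X 0).1)
                         + (omega 1).1 * ((X' 1).1 - (X 1).1)) = 0) ->
  tau * dissipation eta tau N X X' kappa' <=
  energy N sigma X - energy N sigma X'.
Proof.
move=> eta0 tau0 N1 XX XX' Kk X0 motion curvature.
have vel := in_XhZB tau^-1 XX' XX.
have := curvature _ vel; have := motion _ Kk.
have := curve_length_increment_le N1 tau0 X0 XX XX'.
have -> : lumped_inner N X kappa'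
    (fun r => dot2 (normal N X r) (scale2 tau^-1 (X' r - X r))) =
    lumped_inner N X
    (fun r => dot2 (scale2 tau^-1 (X' r - X r)) (normal N X r)) kappa'.
  apply: eq_lumped_inner => r; rewrite mulrC; congr (_ * _).
  by rewrite /dot2; ring.
set A := arc_inner2 _ _ _ _; set L := lumped_inner _ _ _ _.
set K := arc_inner _ _ _ _ => len LK0 balance.
have KE : K = - L by apply/eqP; rewrite -addr_eq0 addrC LK0.
have AE : A = L
    + sigma * (tau^-1 * ((X' 1).1 - (X 1).1) - tau^-1 * ((X' 0).1 - (X 0).1))
    - (eta * tau)^-1 *
        (tau^-1 * ((X' 0).1 - (X 0).1) * ((X' 0).1 - (X 0).1)
         + tau^-1 * ((X' 1).1 - (X 1).1) * ((X' 1).1 - (X 1).1)).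
  apply/eqP; rewrite -subr_eq0 -oppr_eq0 -[X in _ == X]balance /scale2 /=.
  by apply/eqP; ring.
have -> : tau * dissipation eta tau N X X' kappa' =
    - (tau * A) + sigma * ((X' 1).1 - (X 1).1 - ((X' 0).1 - (X 0).1)).
  by rewrite /dissipation -/K KE AE; field; rewrite !gt_eqF.
rewrite /energy; lra.
Qed.

Theorem theorem4p2 (R : realType) (sigma eta tau : R) (N : nat)
    (X : nat -> R -> R * R) (kappa : nat -> R -> R)
    (hsigma : -1 < sigma < 1) (heta : 0 < eta) (htau : 0 < tau)
    (hN : (1 <= N)%N)
    (hX : forall m : nat, in_Xh N (X m))
    (hkappa : forall m : nat, in_Kh N (kappa m.+1))
    (hedge : forall m j : nat, (1 <= j <= N)%N -> 0 < norm2 (edge N (X m) j))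
    (hlr0 : (X 0%N 0).1 < (X 0%N 1).1)
    (hlr : forall m : nat, (X m 0).1 <= (X m 1).1)
    (hmotion : forall (m : nat) (psi : R -> R), in_Kh N psi ->
       lumped_inner N (X m)
         (fun r => dot2 (scale2 tau^-1 (X m.+1 r - X m r)) (normal N (X m) r))
         psi
       + arc_inner N (X m) (arc_deriv N (X m) (kappa m.+1)) (arc_deriv N (X m) psi) = 0)
    (hcurvature : forall (m : nat) (omega : R -> R * R), in_Xh N omega ->
       lumped_inner N (X m) (kappa m.+1)
         (fun r => dot2 (normal N (X m) r) (omega r))
       - arc_inner2 N (X m) (arc_deriv2 N (X m) (X m.+1)) (arc_deriv2 N (X m) omega)
       + sigma * ((omega 1).1 - (omega 0).1)
       - (eta * tau)^-1 * ((omega 0).1 * ((X m.+1 0).1 - (X m 0).1)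
                           + (omega 1).1 * ((X m.+1 1).1 - (X m 1).1)) = 0) :
  (forall m : nat,
     [/\ energy N sigma (X m.+1) <= energy N sigma (X m),
         energy N sigma (X m) <= energy N sigma (X 0%N)
       & energy N sigma (X 0%N) =
         curve_length N (X 0%N) - sigma * ((X 0%N 1).1 - (X 0%N 0).1)]) /\
  (forall m : nat,
     \sum_(1 <= k < m.+2)
       (arc_inner N (X k.-1) (arc_deriv N (X k.-1) (kappa k))
                             (arc_deriv N (X k.-1) (kappa k))
        + eta^-1 * (((X k 0).1 - (X k.-1 0).1) / tau) ^+ 2
        + eta^-1 * (((X k 1).1 - (X k.-1 1).1) / tau) ^+ 2)
     <= (energy N sigma (X 0%N) - energy N sigma (X m.+1)) / tau).
Proof.
have step m : tau * dissipation eta tau N (X m) (X m.+1) (kappa m.+1) <=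
    energy N sigma (X m) - energy N sigma (X m.+1).
  by apply: energy_step => //; [exact: hedge|exact: hmotion|exact: hcurvature].
have decr m : energy N sigma (X m.+1) <= energy N sigma (X m).
  rewrite -subr_ge0; apply: le_trans (step m).
  by apply: mulr_ge0 (ltW htau) _; exact: dissipation_ge0.
split=> m.
  split=> //; elim: m => [//|m IHm]; exact: le_trans (decr m) IHm.
rewrite ler_pdivlMr// mulrC mulr_sumr big_add1/=.
rewrite -opprB -(telescope_sumr (fun k => energy N sigma (X k)) (leq0n m.+1)).
rewrite -sumrN; apply: ler_sum => k _; rewrite opprB; exact: step.
Qed.
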